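(* Consider a packetized flow with packet-level arrival curve $\alpha_{\mathrm{pkt}}$ and packet lengths in $[L^{\min},L^{\max}]$, $L^{\min}>0$. Then: 1. The flow conforms to a $g$-regularity constraint with $$g(x)=\alpha_{\mathrm{pkt}}^{\downarrow}\Big(\frac{x}{L^{\max}}+1\Big),$$ and to a bit-level arrival curve constraint with $$\alpha(t)=L^{\max}\,\alpha_{\mathrm{pkt}}(t).$$ 2. This $g$-regularity constraint is stronger than this bit-level arrival curve constraint, in the following sense. Deriving a bit-level arrival curve from $g$ by the rule $t\mapsto g^{\downarrow}(t)+L^{\max}$ ($t>0$) gives exactly $\alpha$; whereas deriving a regularity constraint from $\alpha$ by the rule $g'(x)=\alpha^{\downarrow}(x+L^{\min})$ for $x>0$, $g'(0)=0$, gives a worse (weaker) constraint than $g$, i.e. $g'\le g$ and $g'\ne g$, except if all packets have the same size ($L^{\min}=L^{\max}$).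
   Context: $\mathcal F^0_{\mathrm{inc}}$ is the set of wide-sense increasing functions $w:[0,\infty)\to[0,\infty]$ with $w(0)=0$. The lower pseudo-inverse is $w^{\downarrow}(x)=\inf\{s\ge 0: w(s)\ge x\}$ (with $\inf\emptyset=+\infty$). The packets of the flow are numbered $1,2,\dots$ in order of arrival, with arrival times $A_n$ and lengths $l_n\in[L^{\min},L^{\max}]$ bits; all bits of a packet arrive at the same instant. $N(t)$ (resp. $\mathcal A(t)$) is the number of packets (resp. bits) arrived until time $t$ (excluded). The flow has packet-level arrival curve $\alpha_{\mathrm{pkt}}$ (a wide-sense increasing function from $[0,\infty)$ to the nonnegative integers with $\alpha_{\mathrm{pkt}}(0)=0$) if $N(t)-N(s)\le\alpha_{\mathrm{pkt}}(t-s)$ for all $0\le s\le t$; packet-level arrival curves are assumed sub-additive, left-continuous, with right limit $\alpha_{\mathrm{pkt}}^+(0)\ge1$. The flow has bit-level arrival curve $\alpha\in\mathcal F^0_{\mathrm{inc}}$ if $\mathcal A(t)-\mathcal A(s)\le\alpha(t-s)$ for all $0\le s\le t$. The flow conforms to a $g$-regularity constraint ($g\in\mathcal F^0_{\mathrm{inc}}$ left-continuous) if $A_n-A_m\ge g\big(\sum_{k=m}^{n-1}l_k\big)$ for all $m\le n$. *)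

(* Defs.v *)
From HB Require Import structures.
From mathcomp Require Import all_boot all_order all_algebra.
From mathcomp Require Import all_classical all_reals all_analysis.
Set Implicit Arguments.
Unset Strict Implicit.
Unset Printing Implicit Defensive.
Import Order.TTheory GRing.Theory Num.Theory.
Import numFieldNormedType.Exports.
Local Open Scope classical_set_scope.
Local Open Scope ring_scope.

(* A function [0, oo) -> [0, oo] is a function R -> \bar R whose values at
   negative arguments are never looked at. *)

(* Nonnegativity on [0, oo) follows from the two clauses. *)
Definition F0inc (R : realType) (w : R -> \bar R) : Prop :=
  w 0 = 0%E /\ forall x y : R, 0 <= x -> x <= y -> (w x <= w y)%E.

Definition left_continuous (R : realType) (w : R -> \bar R) : Prop :=
  forall t : R, 0 < t -> w s @[s --> t^'-] --> w t.

Definition lower_pinv (R : realType) (w : R -> \bar R) (x : R) : \bar R :=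
  ereal_inf [set s%:E | s in [set s : R | 0 <= s /\ (x%:E <= w s)%E]].

(* Packets are numbered from 1; [None] stands for an infinite flow and [Some M]
   for a flow of M packets. *)
Definition is_number (M : option nat) (n : nat) : bool :=
  (0 < n)%N && (if M is Some M' then (n <= M')%N else true).

Record packet_flow (R : realType) : Type := PacketFlow {
  npackets : option nat;
  arrival : nat -> R;
  len : nat -> R;
  arrival_ge0 : forall n, is_number npackets n -> 0 <= arrival n;
  arrival_le : forall m n, is_number npackets m -> is_number npackets n ->
    (m <= n)%N -> arrival m <= arrival n;
  len_ge0 : forall n, is_number npackets n -> 0 <= len n
}.

Definition is_packet (R : realType) (f : packet_flow R) (n : nat) : bool :=
  is_number (npackets f) n.

Definition lengths_in (R : realType) (f : packet_flow R) (Lmin Lmax : R) :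
    Prop :=
  forall n, is_packet f n -> Lmin <= len f n <= Lmax.

Definition arrived (R : realType) (f : packet_flow R) (t : R) : set nat :=
  [set n | is_packet f n /\ arrival f n < t].

(* Both counts are +oo when infinitely many packets arrive before t. Since they
   vanish at t = 0, the arrival curve constraint for s = 0 excludes this as soon
   as the curve is finite, so that oo - oo plays no role there. *)
Definition packets_until (R : realType) (f : packet_flow R) (t : R) : \bar R :=
  counting (arrived f t).

Definition bits_until (R : realType) (f : packet_flow R) (t : R) : \bar R :=
  (\esum_(n in arrived f t) (len f n)%:E)%E.

Definition pkt_curve_fun (R : realType) (a : R -> nat) (t : R) : \bar R :=
  (a t)%:R%:E.

Definition pkt_curve (R : realType) (a : R -> nat) : Prop :=
  [/\ F0inc (pkt_curve_fun a),
      forall s t : R, 0 <= s -> 0 <= t -> (a (s + t)%R <= a s + a t)%N,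
      left_continuous (pkt_curve_fun a)
    & (1 <= lim (pkt_curve_fun a t @[t --> (0 : R)^'+]))%E].

Definition has_pkt_arrival_curve (R : realType) (f : packet_flow R)
    (a : R -> nat) : Prop :=
  pkt_curve a /\
  forall s t : R, 0 <= s -> s <= t ->
    (packets_until f t - packets_until f s <= pkt_curve_fun a (t - s)%R)%E.

Definition has_bit_arrival_curve (R : realType) (f : packet_flow R)
    (alpha : R -> \bar R) : Prop :=
  F0inc alpha /\
  forall s t : R, 0 <= s -> s <= t ->
    (bits_until f t - bits_until f s <= alpha (t - s)%R)%E.

Definition regular (R : realType) (f : packet_flow R) (g : R -> \bar R) :
    Prop :=
  [/\ F0inc g, left_continuous g
    & forall m n : nat, is_packet f m -> is_packet f n -> (m <= n)%N ->
        (g (\sum_(m <= k < n) len f k)%R <= (arrival f n - arrival f m)%R%:E)%E].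

Definition pkt_regularity (R : realType) (Lmax : R) (a : R -> nat) (x : R) :
    \bar R :=
  lower_pinv (pkt_curve_fun a) (x / Lmax + 1).

Definition pkt_bit_curve (R : realType) (Lmax : R) (a : R -> nat) (t : R) :
    \bar R :=
  (Lmax%:E * pkt_curve_fun a t)%E.

(* Both derived functions are set to 0 at 0, so as to lie in F0inc. *)
Definition curve_of_regularity (R : realType) (Lmax : R) (g : R -> \bar R)
    (t : R) : \bar R :=
  if 0 < t then (lower_pinv g t + Lmax%:E)%E else 0%E.

Definition regularity_of_curve (R : realType) (Lmin : R) (alpha : R -> \bar R)
    (x : R) : \bar R :=
  if 0 < x then lower_pinv alpha (x + Lmin) else 0%E.

(* Main.v *)
Require Import Defs.
From HB Require Import structures.
From mathcomp Require Import all_boot all_order all_algebra.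
From mathcomp Require Import finmap.
From mathcomp Require Import all_classical all_reals all_analysis.
From mathcomp Require Import zify ring lra.
Import Order.TTheory GRing.Theory Num.Theory.
Import numFieldNormedType.Exports.
Local Open Scope ring_scope.

(* A regularity constraint and an arrival curve are pseudo-inverse descriptions
   of the same counting bound. For packets m <= n, every window slightly longer
   than A_n - A_m contains n - m + 1 arrivals, and l_m + ... + l_(n-1) is at most
   (n - m) Lmax; this gives g. Since a is integer-valued and left-continuous it
   is constant just to the left of any t > 0, whence
     t <= g x  <->  a t < x / Lmax + 1,
   and g is inverted exactly: its pseudo-inverse at t is Lmax (a t - 1).
   When Lmin < Lmax, the constraint derived from alpha loses at
   x = Lmax (k - 1) + (Lmax - Lmin), with k = a(0+) the smallest value of a on
   t > 0: there x + Lmin = Lmax k is reached at arbitrarily small times, whereas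
   x / Lmax + 1 > k is not. *)

(** * Lower pseudo-inverses and their left-continuity *)

Section LowerPseudoInverse.
Context {R : realType}.
Implicit Types (w h : R -> \bar R) (s t x y : R).

Lemma lower_pinv_le w x s : 0 <= s -> (x%:E <= w s)%E ->
  (lower_pinv w x <= s%:E)%E.
Proof. by move=> s0 xs; apply: ereal_inf_lbound; exists s. Qed.

Lemma lower_pinv_geP w x (z : \bar R) :
  (forall s, 0 <= s -> (x%:E <= w s)%E -> (z <= s%:E)%E) <->
  (z <= lower_pinv w x)%E.
Proof.
split=> [zs|/ereal_infP zw s s0 xs]; last by apply: zw; exists s.
by apply/ereal_infP => _ [s [s0 xs] <-]; exact: zs.
Qed.

Lemma lower_pinv_ltP w x (z : \bar R) : (lower_pinv w x < z)%E ->
  exists s, [/\ 0 <= s, (x%:E <= w s)%E & (s%:E < z)%E].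
Proof. by move=> /ereal_inf_ltP[_ [s [s0 xs] <-] sz]; exists s. Qed.

Lemma lower_pinv_ge0 w x : (0 <= lower_pinv w x)%E.
Proof. by apply/lower_pinv_geP => s s0 _; rewrite lee_fin. Qed.

Lemma lower_pinv_nondecreasing w x y : x <= y ->
  (lower_pinv w x <= lower_pinv w y)%E.
Proof.
move=> xy; apply/lower_pinv_geP => s s0 ys; apply: lower_pinv_le => //.
by apply: le_trans ys; rewrite lee_fin.
Qed.

(** For [e > 0], [w (z + e)] is at least every [y < x], hence at least [x]. This is what
    left-continuity of the pseudo-inverse amounts to. *)
Lemma lower_pinv_left_sup w x (z : \bar R) :
  (forall s t, 0 <= s -> s <= t -> (w s <= w t)%E) ->
  (forall y, y < x -> (lower_pinv w y <= z)%E) -> (lower_pinv w x <= z)%E.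
Proof.
move=> w_nd; case: z => [r||] yz; last 2 first.
- exact: leey.
- by have /(le_trans (lower_pinv_ge0 _ _)) := yz (x - 1) ltac:(lra).
have r0 : 0 <= r.
  rewrite -lee_fin; apply: le_trans (yz (x - 1) ltac:(lra)).
  exact: lower_pinv_ge0.
apply/lee_addgt0Pr => e e0; rewrite -EFinD.
apply: lower_pinv_le; first lra.
have yw y : y < x -> (y%:E <= w (r + e)%R)%E.
  move=> /yz yr; have : (lower_pinv w y < (r + e)%R%:E)%E.
    by apply: le_lt_trans yr _; rewrite lte_fin ltrDl.
  move=> /lower_pinv_ltP[s [s0 ys]]; rewrite lte_fin => sre.
  by apply: le_trans ys _; apply: w_nd => //; exact: ltW.
case: (w _) yw => [v||] yw; last 2 first.
- exact: leey.
- by have := yw (x - 1) ltac:(lra).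
rewrite lee_fin; apply/ler_addgt0Pr => d d0.
by have := yw (x - d) ltac:(lra); rewrite lee_fin; lra.
Qed.

(** The second hypothesis makes [h x] the supremum of [h] to the left of [x]. Reflection by [-%R]
    turns the claim into a right limit of a nonincreasing function. *)
Lemma nondecreasing_left_cvg h x : {homo h : s t / s <= t >-> (s <= t)%E} ->
  (forall z, (forall y, y < x -> (h y <= z)%E) -> (h x <= z)%E) ->
  (h s @[s --> x^'-] --> h x)%classic.
Proof.
move=> h_nd h_sup; apply/cvg_at_leftNP.
suff -> : h x =
    ereal_sup ((h \o -%R) @` [set` Interval (BRight (- x)) +oo%O])%classic.
  apply: nonincreasing_at_right_cvge => //= s t _ _ st.
  by apply: h_nd; rewrite lerN2.
apply/eqP; rewrite eq_le; apply/andP; split.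
  apply: h_sup => y yx; apply: ereal_sup_ubound.
  by exists (- y) => /=; rewrite ?opprK// in_itv/= andbT ltrN2.
apply: ge_ereal_sup => _ [s /= + <-]; rewrite in_itv/= andbT => xs.
by apply: h_nd; lra.
Qed.

End LowerPseudoInverse.

(** * Packet-level curves: the functions derived from [a], without any flow *)

Section PacketCurve.
Context {R : realType} {a : R -> nat} (ca : pkt_curve a).
Implicit Types (s t x : R).

Lemma pkt_curve0 : a 0 = 0%N.
Proof. by case: ca => -[/eqP + _] _ _ _; rewrite eqe pnatr_eq0 => /eqP. Qed.

Lemma pkt_curve_le s t : 0 <= s -> s <= t -> (a s <= a t)%N.
Proof.
move=> s0 st; case: ca => -[_ /(_ _ _ s0 st)] + _ _ _.
by rewrite lee_fin ler_nat.
Qed.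

(** If [a t = 0], then [a] vanishes on []0, t]] by monotonicity, so its right limit at 0 is 0 and
    not at least 1. *)
Lemma pkt_curve_gt0 t : 0 < t -> (0 < a t)%N.
Proof.
move=> t0; rewrite lt0n; apply/eqP => at0; case: ca => _ _ _.
suff -> : lim (pkt_curve_fun a t @[t --> (0 : R)^'+])%classic = 0%E.
  by rewrite lee_fin ler10.
apply/cvg_lim => //; apply: cvg_near_cst; near=> s.
have s0 : 0 < s by near: s; exact: nbhs_right_gt.
have : (a s <= a t)%N.
  apply: pkt_curve_le; first exact: ltW.
  by near: s; exact: nbhs_right_le.
by rewrite at0 leqn0 => /eqP as0; rewrite /pkt_curve_fun as0.
Unshelve. all: by end_near. Qed.

Lemma pkt_curve_left_attained t : 0 < t ->
  exists s, [/\ 0 <= s, s < t & a s = a t].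
Proof.
move=> t0; case: ca => _ _ lc _.
suff : (\forall s \near t^'-, [/\ 0 <= s, s < t & a s = a t])%classic.
  by move=> near_t; apply: (@filter_ex _ (t^'-)%classic).
(* For integers, [a s > a t - 1/2] and [a s <= a t] force equality. *)
have gt_at : (\forall s \near t^'-,
    ((a t)%:R - 2^-1)%R%:E < pkt_curve_fun a s)%E%classic.
  apply: (lc t t0 [set y | ((a t)%:R - 2^-1)%R%:E < y]%E%classic).
  by apply: open_ereal_gt'; rewrite lte_fin gtrBl invr_gt0.
near=> s.
have s0 : 0 <= s by near: s; exact: nbhs_left_ge.
have st : s < t by near: s; exact: nbhs_left_lt.
split=> //; apply/eqP; rewrite eqn_leq pkt_curve_le ?(ltW st)//= leqNgt.
apply/negP; rewrite -(ler_nat R) -natr1 => as_lt.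
have : ((a t)%:R - 2^-1 < (a s)%:R :> R) by rewrite -lte_fin; near: s.
by apply/negP; rewrite -leNgt; lra.
Unshelve. all: by end_near. Qed.

(** The inequality is strict because the value [a t] is already taken at some [s < t]: were
    [x / L + 1 <= a t], that [s] would push the infimum below [t]. *)
Lemma le_pkt_regularity (L t x : R) : 0 < t ->
  (t%:E <= pkt_regularity L a x)%E <-> (a t)%:R < x / L + 1.
Proof.
move=> t0; split=> [tg|atx].
  have [s [s0 st asE]] := pkt_curve_left_attained _ t0.
  rewrite ltNge; apply/negP => xat.
  have := lt_le_trans (_ : (s%:E < t%:E)%E) tg; rewrite lte_fin => /(_ st).
  by apply/negP; rewrite -leNgt; apply: lower_pinv_le; rewrite // lee_fin asE.
apply/lower_pinv_geP => s s0; rewrite !lee_fin => xas.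
rewrite leNgt; apply/negP => st.
have := le_lt_trans xas (le_lt_trans (_ : (a s)%:R <= (a t)%:R) atx).
by rewrite ltxx ler_nat => /(_ (pkt_curve_le _ _ s0 (ltW st))).
Qed.

(** The value at 0 is the pseudo-inverse of [a] at level 1, a level reached at every positive
    time. *)
Lemma F0inc_pkt_regularity (L : R) : 0 < L -> F0inc (pkt_regularity L a).
Proof.
move=> L0; split=> [|x y x0 xy]; last first.
  by apply: lower_pinv_nondecreasing; rewrite lerD2r ler_pM2r ?invr_gt0.
apply/eqP; rewrite eq_le lower_pinv_ge0 andbT; apply/lee_addgt0Pr => e e0.
rewrite add0e; apply: lower_pinv_le; first exact: ltW.
by rewrite mul0r add0r lee_fin ler1n pkt_curve_gt0.
Qed.

Lemma left_continuous_pkt_regularity (L : R) : 0 < L ->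
  left_continuous (pkt_regularity L a).
Proof.
move=> L0 t _; apply: nondecreasing_left_cvg => [x y xy|z gz].
  by apply: lower_pinv_nondecreasing; rewrite lerD2r ler_pM2r ?invr_gt0.
apply: lower_pinv_left_sup => [u v u0 uv|y yt].
  by rewrite lee_fin ler_nat pkt_curve_le.
(* The point that [x / L + 1] sends to [y]. *)
have := gz ((y - 1) * L); rewrite /pkt_regularity mulfK ?gt_eqF// subrK.
by apply; rewrite -ltr_pdivlMr// ltrBlDr.
Qed.

Lemma F0inc_pkt_bit_curve (L : R) : 0 <= L -> F0inc (pkt_bit_curve L a).
Proof.
move=> L0; split=> [|x y x0 xy].
  by rewrite /pkt_bit_curve /pkt_curve_fun pkt_curve0 mule0.
by rewrite lee_fin ler_wpM2l// ler_nat pkt_curve_le.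
Qed.

Lemma lower_pinv_pkt_regularity (L t : R) : 0 < L -> 0 < t ->
  lower_pinv (pkt_regularity L a) t = (L * ((a t)%:R - 1))%:E.
Proof.
move=> L0 t0; apply/eqP; rewrite eq_le; apply/andP; split.
  (* The condition [L * (a t - 1) < x] is strict, so the infimum is not attained but approached
     through [e]. *)
  apply/lee_addgt0Pr => e e0; rewrite -EFinD; apply: lower_pinv_le.
    rewrite addr_ge0 ?(ltW e0)// mulr_ge0 ?(ltW L0)//.
    by rewrite subr_ge0 ler1n pkt_curve_gt0.
  apply/le_pkt_regularity => //.
  by rewrite -ltrBlDr ltr_pdivlMr// mulrC ltrDl.
apply/lower_pinv_geP => s s0 /(le_pkt_regularity _ _ _ t0).
by rewrite -ltrBlDr ltr_pdivlMr// mulrC lee_fin => /ltW.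
Qed.

Lemma curve_of_pkt_regularity (L t : R) : 0 < L -> 0 <= t ->
  curve_of_regularity L (pkt_regularity L a) t = pkt_bit_curve L a t.
Proof.
move=> L0; rewrite le_eqVlt => /predU1P[<-|t0].
  by rewrite /curve_of_regularity ltxx (F0inc_pkt_bit_curve _ (ltW L0)).1.
rewrite /curve_of_regularity t0 lower_pinv_pkt_regularity// -EFinD.
by rewrite /pkt_bit_curve /pkt_curve_fun -EFinM mulrBr mulr1 subrK.
Qed.

(** A time with [a s >= x / L + 1] reaches the bit level [x + L], hence also [x + l]. *)
Lemma le_regularity_of_curve (l L x : R) : 0 < L -> l <= L -> 0 <= x ->
  (regularity_of_curve l (pkt_bit_curve L a) x <= pkt_regularity L a x)%E.
Proof.
move=> L0 lL x0; rewrite /regularity_of_curve.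
case: ifP => _; last exact: lower_pinv_ge0.
apply/lower_pinv_geP => s s0; rewrite lee_fin => xas.
apply: lower_pinv_le => //; rewrite lee_fin.
apply: (@le_trans _ _ (x + L)); first by rewrite lerD2l.
by rewrite mulrC -ler_pdivrMr// mulrDl divff ?gt_eqF.
Qed.

Lemma regularity_of_curve_eq (L x : R) : 0 < L -> 0 <= x ->
  regularity_of_curve L (pkt_bit_curve L a) x = pkt_regularity L a x.
Proof.
move=> L0; rewrite le_eqVlt => /predU1P[<-|x0].
  by rewrite /regularity_of_curve ltxx (F0inc_pkt_regularity _ L0).1.
rewrite /regularity_of_curve x0 /lower_pinv; congr ereal_inf.
congr image; apply/funext => s /=; congr (_ /\ _).
rewrite /pkt_bit_curve /pkt_curve_fun -EFinM !lee_fin mulrC.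
by rewrite -ler_pdivrMr// mulrDl divff ?gt_eqF.
Qed.

Lemma regularity_of_curve_lt (l L : R) : 0 < L -> l < L ->
  exists2 x, 0 <= x &
    (regularity_of_curve l (pkt_bit_curve L a) x < pkt_regularity L a x)%E.
Proof.
move=> L0 lL.
have a_pos : exists n, `[< exists2 t, 0 < t & a t = n >].
  by exists (a 1); apply/asboolP; exists 1.
(* As [a] equals its minimum [k] on []0, t]], the time [t] separates the two constraints at the [x]
   below. *)
case: (ex_minnP a_pos) => k /asboolP[t t0 atk] k_min.
have k_le s : 0 < s -> (k <= a s)%N.
  by move=> s0; apply: k_min; apply/asboolP; exists s.
have k0 : (1 <= k)%N by rewrite -atk pkt_curve_gt0.
pose x : R := L * (k%:R - 1) + (L - l).
have x0 : 0 < x.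
  rewrite ltr_wpDl ?subr_gt0// mulr_ge0 ?(ltW L0)//.
  by rewrite subr_ge0 ler1n.
exists x; first exact: ltW.
apply: (@lt_le_trans _ _ t%:E); last first.
  apply/le_pkt_regularity => //.
  by rewrite atk -ltrBlDr ltr_pdivlMr// mulrC ltrDl subr_gt0.
(* Any time in []0, t[] could replace [t / 2], since [L * k] bits are allowed at all of them. *)
apply: (@le_lt_trans _ _ (t / 2)%:E); last by rewrite lte_fin; lra.
rewrite /regularity_of_curve x0; apply: lower_pinv_le; first lra.
have -> : x + l = L * k%:R by rewrite /x; ring.
by rewrite lee_fin ler_pM2l// ler_nat k_le//; lra.
Qed.

End PacketCurve.

(** * Cardinals and sums over finite sets *)

Section Counting.
Context {R : realType}.

Lemma counting_ge_size (A : set nat) (r : seq nat) : uniq r ->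
  {in r, forall i, A i} -> ((size r)%:R%:E <= counting A :> \bar R)%E.
Proof.
move=> ur rA; rewrite /counting; case: asboolP => [finA|_]; last exact: leey.
rewrite lee_fin ler_nat; apply: uniq_leq_size => // i /rA Ai.
by rewrite in_fset_set//; exact: mem_set.
Qed.

Lemma counting_le_size (A : set nat) (r : seq nat) :
  (forall i, A i -> i \in r) -> (counting A <= (size r)%:R%:E :> \bar R)%E.
Proof.
move=> Ar; rewrite /counting asboolT; last first.
  by apply: sub_finite_set (finite_seq r) => i /Ar.
rewrite lee_fin ler_nat; apply: uniq_leq_size => // i.
rewrite in_fset_set; first by rewrite inE; exact: Ar.
by apply: sub_finite_set (finite_seq r) => j /Ar.
Qed.

(** Each [F i - c] is nonpositive on [B], so its sum can only decrease from [A] to the larger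
    [B]. *)
Lemma fset_sumB_le (T : choiceType) (A B : {fset T}) (F : T -> R) (c : R) :
  (A `<=` B)%fset -> {in B, forall i, F i <= c} ->
  \sum_(i <- B) F i - \sum_(i <- A) F i <= c * (#|` B|%:R - #|` A|%:R).
Proof.
move=> AB Fc.
have sumE (C : {fset T}) :
    \sum_(i <- C) (F i - c) = \sum_(i <- C) F i - c * #|` C|%:R.
  rewrite sumrB big_const_seq count_predT iter_addr addr0.
  by rewrite [in RHS]mulr_natr.
suff : \sum_(i <- B) (F i - c) <= \sum_(i <- A) (F i - c) by rewrite !sumE; lra.
rewrite (big_fsetID _ (mem A))/=.
have -> : [fset x in B | x \in A]%fset = A.
  by apply/fsetP => i; rewrite !inE/= andb_idl//; exact: (fsubsetP AB).
rewrite gerDl big_seq; apply: sumr_le0 => i; rewrite !inE/= => /andP[iB _].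
by rewrite subr_le0 Fc.
Qed.

End Counting.

(** * Constraints satisfied by the flow *)

Section Flow.
Context {R : realType} {f : packet_flow R}.

Lemma is_packet_le m n : (0 < m)%N -> (m <= n)%N -> is_packet f n ->
  is_packet f m.
Proof.
rewrite /is_packet /is_number => -> mn /andP[_].
by case: npackets => // M; exact: leq_trans.
Qed.

(** Counting strictly before the arrival of [n] leaves out [n] and all later packets; simultaneous
    arrivals can make the count smaller still. *)
Lemma packets_until_le n : is_packet f n ->
  (packets_until f (arrival f n) <= n.-1%:R%:E)%E.
Proof.
move=> fn; rewrite -[n.-1](size_iota 1).
apply: counting_le_size => i [fi arr_lt].
rewrite mem_iota add1n prednK; last by case/andP: fn.
have -> /= : (1 <= i)%N by case/andP: fi.
by rewrite ltnNge; apply/negP => /(arrival_le fn fi); rewrite leNgt arr_lt.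
Qed.

Lemma packets_until_ge n t : is_packet f n -> arrival f n < t ->
  (n%:R%:E <= packets_until f t)%E.
Proof.
move=> fn nt; rewrite -[in X in (X <= _)%E](size_iota 1 n).
apply: counting_ge_size; first exact: iota_uniq.
move=> i; rewrite mem_iota add1n ltnS => /andP[i0 i_n].
have fi := is_packet_le _ _ i0 i_n fn.
by split=> //; apply: le_lt_trans nt; exact: arrival_le.
Qed.

(** Nothing arrives before time 0, so the curve with [s = 0] bounds the count by a finite number,
    whereas [counting] is infinite on infinite sets. *)
Lemma finite_arrived (a : R -> nat) t : has_pkt_arrival_curve f a -> 0 <= t ->
  finite_set (arrived f t).
Proof.
move=> [_ af] t0; have := af 0 t (lexx _) t0.
have -> : packets_until f 0 = 0%E.
  apply/eqP; rewrite eq_le; apply/andP; split; last first.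
    by have := counting_ge_size (R := R) (arrived f 0) [::] isT; apply.
  apply: (counting_le_size _ [::]) => i [/arrival_ge0].
  by rewrite leNgt => /negP.
by rewrite sube0 /packets_until /counting; case: asboolP.
Qed.

Lemma regular_pkt_regularity (a : R -> nat) (L : R) : 0 < L ->
  (forall n, is_packet f n -> len f n <= L) -> has_pkt_arrival_curve f a ->
  regular f (pkt_regularity L a).
Proof.
move=> L0 len_le [ca af]; split; first exact: F0inc_pkt_regularity.
  exact: left_continuous_pkt_regularity.
(* Arrivals are counted strictly before a time, so the window must extend by [e] past the arrival of
   [n] to contain it. *)
move=> m n fm fn mn; apply/lee_addgt0Pr => e e0; rewrite -EFinD.
have Am := arrival_ge0 fm; have Amn := arrival_le fm fn mn.
have m0 : (0 < m)%N by case/andP: fm.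
apply: lower_pinv_le; first lra.
(* The window holds at least [n - m + 1] packets: [n - m] of them account for the lengths divided by
   [L], one for the [+ 1]. *)
apply: (@le_trans _ _ (n%:R - m.-1%:R)%:E).
  rewrite lee_fin -natrB; last exact: leq_trans (leq_pred m) mn.
  have -> : (n - m.-1 = n - m + 1)%N by lia.
  rewrite natrD lerD2r ler_pdivrMr// mulr_natl -sumr_const_nat.
  rewrite big_seq [leRHS]big_seq; apply: ler_sum => k.
  rewrite mem_index_iota => /andP[mk kn]; apply: len_le.
  by apply: is_packet_le (ltnW kn) fn; exact: leq_trans mk.
have := af (arrival f m) (arrival f n + e) Am ltac:(lra).
have -> : arrival f n + e - arrival f m = arrival f n - arrival f m + e by ring.
apply: le_trans; rewrite EFinB; apply: leeB.
  by apply: packets_until_ge => //; rewrite ltrDl.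
exact: packets_until_le.
Qed.

Lemma bit_arrival_curve_pkt_bit_curve (a : R -> nat) (L : R) : 0 <= L ->
  (forall n, is_packet f n -> len f n <= L) -> has_pkt_arrival_curve f a ->
  has_bit_arrival_curve f (pkt_bit_curve L a).
Proof.
move=> L0 len_le haf; have [ca af] := haf.
split=> [|s t s0 st]; first exact: F0inc_pkt_bit_curve.
have fin_s := finite_arrived _ _ haf s0.
have fin_t := finite_arrived _ _ haf (le_trans s0 st).
have := af s t s0 st; rewrite /packets_until /counting !asboolT// -EFinB lee_fin.
have bitsE u : finite_set (arrived f u) ->
    bits_until f u = (\sum_(n <- fset_set (arrived f u)) len f n)%:E.
  move=> fin_u; rewrite /bits_until esum_fset// => [|n]; last first.
    by rewrite inE lee_fin => -[/len_ge0].
  by rewrite fsumEFin// fsbig_finite.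
move=> card_le; rewrite !bitsE// -EFinB lee_fin.
(* Each packet arriving in [[s, t[] brings at most [L] bits. *)
apply: (le_trans _ (ler_wpM2l L0 card_le)); apply: fset_sumB_le.
  rewrite -fset_set_sub// => n [fn ns]; split=> //; exact: lt_le_trans st.
by move=> n; rewrite in_fset_set// inE => -[/len_le].
Qed.

End Flow.

Theorem proposition2 (R : realType) (f : packet_flow R) (a : R -> nat)
    (Lmin Lmax : R) (hLmin : 0 < Lmin) (hL : Lmin <= Lmax)
    (hlen : lengths_in f Lmin Lmax) (ha : has_pkt_arrival_curve f a) :
  let g := pkt_regularity Lmax a in
  let alpha := pkt_bit_curve Lmax a in
  let g' := regularity_of_curve Lmin alpha in
  (regular f g /\ has_bit_arrival_curve f alpha) /\
  [/\ forall t : R, 0 <= t -> curve_of_regularity Lmax g t = alpha t,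
      forall x : R, 0 <= x -> (g' x <= g x)%E
    & (forall x : R, 0 <= x -> g' x = g x) <-> Lmin = Lmax].
Proof.
have L0 := lt_le_trans hLmin hL; have [ca _] := ha.
have len_le n : is_packet f n -> len f n <= Lmax by move=> /hlen/andP[].
move=> g alpha g'; split; first split.
- exact: regular_pkt_regularity.
- by apply: bit_arrival_curve_pkt_bit_curve => //; exact: ltW.
split=> [t t0|x x0|].
- exact: curve_of_pkt_regularity.
- exact: le_regularity_of_curve.
split=> [g'g|LminE x x0]; last by rewrite /g' LminE; exact: regularity_of_curve_eq.
apply/eqP; rewrite eq_le hL leNgt; apply/negP => Lmin_lt.
have [x x0] := regularity_of_curve_lt ca _ _ L0 Lmin_lt.
by rewrite -/g' -/g -/alpha -/g' g'g// ltxx.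
Qed.
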